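(* Let $Q=[(n_1,q_1),\dots,(n_m,q_m)]$ be a compatible pointed irregular type with fission tree nodes as defined in the context, and let $\mathbb A^\flat$ be the set of admissible nodes of height $\le K$. Let $\mathcal R$ be the set of maps $c:\mathbb A^\flat\to\mathbb C$ such that (1) $c(v)\ne0$ for every mandatory node $v$; (2) $c(u)\ne c(w)$ for any two distinct admissible, non-mandatory nodes $u,w$ with the same parent; (3) $c(u)^N\ne c(w)^N$ for any two distinct mandatory nodes $u,w$ with the same parent $p$, where $N=N_p$. Then the map $\mathcal R\to\mathbb C^{ms}$, $c\mapsto\mathbf a(c)$, with $a_{i,j}(c)=c(\langle\tau_{j/r}(q_i)\rangle)$ if $j/r\in A(\mathrm{Levels}(q_i))$ and $a_{i,j}(c)=0$ otherwise, is a homeomorphism of $\mathcal R$ (with the topology from $\mathbb C^{\mathbb A^\flat}$) onto $\mathbf B(Q)$.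
   Context: Exponential factors: finite sums $q=\sum_ka_kx^k$, $a_k\in\mathbb C$, $k\in\mathbb Q_{>0}$; $\mathrm{slope}(q)$ = largest exponent with nonzero coefficient ($0$ if $q=0$); $\mathrm{ram}(q)$ = least $r\ge1$ with $q\in x^{1/r}\mathbb C[x^{1/r}]$. Galois operator $\sigma(\sum a_kx^k)=\sum a_ke^{-2\pi\sqrt{-1}k}x^k$; Stokes circle $\langle q\rangle=\{\sigma^i(q)\}$, $\mathrm{ram}\langle q\rangle:=\mathrm{ram}(q)$. Truncation $\tau_k(\sum a_{k'}x^{k'})=\sum_{k'\ge k}a_{k'}x^{k'}$. $\mathrm{Levels}(q)=\{\mathrm{slope}(q-\sigma^i(q)):i\in\mathbb Z\}\setminus\{0\}$. For $L=\{k_1>\dots>k_m\}$, $r_i$ = lcm of denominators of $k_1,\dots,k_i$, admissible exponents $A(L)=\mathbb N_{>0}\cup\bigcup_i\big((0,k_i]\cap\frac1{r_i}\mathbb N\big)$. Pointed irregular type $Q=[(n_1,q_1),\dots,(n_m,q_m)]$: $n_i\in\mathbb N_{>0}$, $q_i$ in pairwise distinct orbits; compatible if $\langle\tau_k(q_i)\rangle=\langle\tau_k(q_j)\rangle\Rightarrow\tau_k(q_i)=\tau_k(q_j)$ for all $k\in\mathbb Q_{>0}$, $i,j$. $Q'\sim Q$ means same length and multiplicities and $\mathrm{slope}(\sigma^k(q'_i)-\sigma^l(q'_j))=\mathrm{slope}(\sigma^k(q_i)-\sigma^l(q_j))$ for all $i,j$, $0\le k\le\mathrm{ram}(q_i)$,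 $0\le l\le\mathrm{ram}(q_j)$. Configuration space: $r=\mathrm{lcm}_i\mathrm{ram}(q_i)$, $K=\max_i\mathrm{slope}(q_i)$, $s=rK$, $Q_{\mathbf a}=[(n_i,\sum_{j=1}^sa_{i,j}x^{j/r})]$, $\mathbf B(Q)=\{\mathbf a\in\mathbb C^{ms}:Q_{\mathbf a}\sim Q\}$. Fission tree of compatible $Q$: let $A(Q)=\bigcup_iA(\mathrm{Levels}(q_i))$. For $k\in A(Q)$, the nodes of height $k$ are the Stokes circles $\langle\tau_k(q_i)\rangle$, $1\le i\le m$ (a set $\mathbb V_k$). If $k^-$ is the largest element of $A(Q)$ less than $k$, the parent of a node $\langle\tau_{k^-}(q_i)\rangle$ is $\langle\tau_k(q_i)\rangle$ (and the former is a child of the latter). A node $\langle\tau_k(q_i)\rangle$ is admissible if $k\in A(\mathrm{Levels}(q_i))$ and mandatory if $k\in\mathrm{Levels}(q_i)$. The ramification of a node $v=\langle\tau_k(q_i)\rangle$ is $\mathrm{Ram}(v)=\mathrm{ram}(\tau_k(q_i))$. For a node $v$ of height $k$ whose children have height $k^-$ with denominator $b$ (in lowest terms), $N_v=\mathrm{lcm}(\mathrm{Ram}(v),b)/\mathrm{Ram}(v)$. *)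

(* Defs.v *)
From HB Require Import structures.
From mathcomp Require Import all_boot all_order all_algebra.
From mathcomp Require Import all_classical all_reals all_analysis.
From mathcomp Require Import complex finmap.
Import numFieldTopology.Exports.

Set Implicit Arguments.
Unset Strict Implicit.
Unset Printing Implicit Defensive.

Import Order.TTheory GRing.Theory Num.Theory.
Local Open Scope ring_scope.

(** The complex numbers are [R[i]] for a real field [R : realType];
    they are given the standard (metric) topology of a numeric field. *)
HB.instance Definition _ (R : rcfType) := PseudoPointedMetric.copy R[i] (R[i])^o.

Section ExponentialFactors.
Variable R : realType.
Local Notation C := R[i].

(** Exponential factors: finite sums  q = sum_k a_k x^k,  with k rational;
    q is represented by its (finitely supported) coefficient function k |-> a_k. *)
Definition expf := {fsfun rat -> C with 0}.

Definition is_expf (q : expf) : Prop := forall k, k \in finsupp q -> 0 < k.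

Definition expf0 : expf := [fsfun].

Definition expf_sub (p q : expf) : expf :=
  [fsfun k in fsetU (finsupp p) (finsupp q) => p k - q k].

Definition slope (q : expf) : rat := \big[Num.max/0]_(k <- finsupp q) k.

(** ram(q): least r >= 1 such that q lies in x^{1/r} C[x^{1/r}], i.e. every
    exponent of q lies in (1/r) Z (they are all positive). *)
Definition ram_pred (q : expf) (r : nat) : bool :=
  (0 < r)%N && all (fun k : rat => k * r%:R \is a Num.int) (finsupp q).

Lemma ram_pred_ex (q : expf) : exists r, ram_pred q r.
Proof.
exists (\prod_(k <- finsupp q) `|denq k|)%N; apply/andP; split.
  by rewrite prodn_gt0 // => k; rewrite absz_gt0 gt_eqF ?denq_gt0.
apply/allP => k kq; rewrite (big_rem k kq) /= natrM mulrA.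
have -> : (`|denq k|%:R : rat) = (denq k)%:~R.
  by rewrite -[in RHS](@gez0_abs (denq k)) ?ltW ?denq_gt0.
by rewrite -numqE rpredM ?intr_int // intr_nat ?natr_nat.
Qed.

Definition ram (q : expf) : nat := ex_minn (ram_pred_ex q).

Definition expi (t : rat) : C :=
  Complex (cos (2 * pi * ratr t)) (sin (2 * pi * ratr t)).

Definition galois_op (q : expf) : expf :=
  [fsfun k in finsupp q => q k * expi (- k)].

Definition circ (q : expf) : set expf := [set iter i galois_op q | i in [set: nat]].

(** ram<q> := ram(q) (the representative is chosen by classical choice; the
    value does not depend on it) *)
Definition ram_circ (S : set expf) : nat := ram (xget expf0 S).

Definition trunc (k : rat) (q : expf) : expf :=
  [fsfun k' in [fset k' in finsupp q | k <= k']%fset => q k'].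

Definition Levels (q : expf) : set rat :=
  [set x | (exists i : nat, slope (expf_sub q (iter i galois_op q)) = x) /\ x != 0].

End ExponentialFactors.

Arguments is_expf {R}.
Arguments expf0 {R}.
Arguments expf_sub {R}.
Arguments slope {R}.
Arguments ram {R}.
Arguments expi {R}.
Arguments galois_op {R}.
Arguments circ {R}.
Arguments ram_circ {R}.
Arguments trunc {R}.
Arguments Levels {R}.

(** Admissible exponents A(L) of a (finite) set of levels L = {k_1 > ... > k_m}:
    r_i = lcm of the denominators of k_1, ..., k_i, i.e. of all levels >= k_i. *)
Definition lev_ram (L : set rat) (l : rat) : nat :=
  \big[lcmn/1%N]_(l' <- fset_set L | l <= l') `|denq l'|%N.

Definition admissible_exp (L : set rat) (k : rat) : Prop :=
  (0 < k /\ k \is a Num.int) \/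
  (exists l, L l /\ 0 < k <= l /\ k * (lev_ram L l)%:R \is a Num.nat).

Section PointedIrregularTypes.
Variable R : realType.
Local Notation C := R[i].
Local Notation expf := (expf R).
Variable m : nat.

Definition compatible (q : 'I_m -> expf) : Prop :=
  forall (k : rat), 0 < k -> forall i j : 'I_m,
    circ (trunc k (q i)) = circ (trunc k (q j)) -> trunc k (q i) = trunc k (q j).

Definition irr_sim (n' : 'I_m -> nat) (q' : 'I_m -> expf)
                   (n : 'I_m -> nat) (q : 'I_m -> expf) : Prop :=
  (forall i, n' i = n i) /\
  forall (i j : 'I_m) (k l : nat), (k <= ram (q i))%N -> (l <= ram (q j))%N ->
    slope (expf_sub (iter k galois_op (q' i)) (iter l galois_op (q' j))) =
    slope (expf_sub (iter k galois_op (q i)) (iter l galois_op (q j))).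

Definition rQ (q : 'I_m -> expf) : nat := \big[lcmn/1%N]_(i < m) ram (q i).
Definition KQ (q : 'I_m -> expf) : rat := \big[Num.max/0]_(i < m) slope (q i).
(** s = r K (a natural number) *)
Definition sQ (q : 'I_m -> expf) : nat := `|numq (KQ q * (rQ q)%:R)|%N.

(** Q_a : i-th factor is  sum_{j=1}^s a_{i,j} x^{j/r}  (column j : 'I_s
    stands for the index j+1) *)
Definition Qa (q : 'I_m -> expf) (a : 'M[C]_(m, sQ q)) (i : 'I_m) : expf :=
  [fsfun k in [fset ((val j).+1%:R / (rQ q)%:R : rat) | j : 'I_(sQ q)]%fset =>
     \sum_(j < sQ q | k == (val j).+1%:R / (rQ q)%:R) a i j].

Definition BQ (n : 'I_m -> nat) (q : 'I_m -> expf) : set 'M[C]_(m, sQ q) :=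
  [set a | irr_sim n (Qa a) n q].

(** A node is a pair (height, Stokes circle). *)
Definition node := (rat * set expf)%type.

Definition AQ (q : 'I_m -> expf) (k : rat) : Prop :=
  exists i, admissible_exp (Levels (q i)) k.

Definition node_of (q : 'I_m -> expf) (k : rat) (i : 'I_m) : node :=
  (k, circ (trunc k (q i))).

Definition admissible_node (q : 'I_m -> expf) (v : node) : Prop :=
  exists i, v = node_of q v.1 i /\ admissible_exp (Levels (q i)) v.1.

Definition mandatory_node (q : 'I_m -> expf) (v : node) : Prop :=
  exists i, v = node_of q v.1 i /\ Levels (q i) v.1.

Definition parent (q : 'I_m -> expf) (u p : node) : Prop :=
  exists (i : 'I_m) (k' k : rat),
    [/\ u = node_of q k' i, p = node_of q k i, AQ q k, AQ q k' &
        k' < k /\ forall k'', AQ q k'' -> k'' < k -> k'' <= k'].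

(** Ram(v) and N_v (b = denominator of the height of the children of v) *)
Definition Ram_node (v : node) : nat := ram_circ v.2.
Definition N_node (v : node) (b : nat) : nat :=
  (lcmn (Ram_node v) b %/ Ram_node v)%N.

Definition Aflat (q : 'I_m -> expf) : set node :=
  [set v | admissible_node q v /\ v.1 <= KQ q].

Definition Aflat_type (q : 'I_m -> expf) := {v : node | Aflat q v}.

Definition Rset (q : 'I_m -> expf) : set {ptws Aflat_type q -> C} :=
  [set c |
   (forall v : Aflat_type q, mandatory_node q (proj1_sig v) -> c v != 0) /\
   (forall (u w : Aflat_type q) (p : node),
      ~ mandatory_node q (proj1_sig u) -> ~ mandatory_node q (proj1_sig w) -> u <> w ->
      parent q (proj1_sig u) p -> parent q (proj1_sig w) p -> c u != c w) /\
   (forall (u w : Aflat_type q) (p : node),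
      mandatory_node q (proj1_sig u) -> mandatory_node q (proj1_sig w) -> u <> w ->
      parent q (proj1_sig u) p -> parent q (proj1_sig w) p ->
      c u ^+ N_node p `|denq (proj1_sig u).1|%N != c w ^+ N_node p `|denq (proj1_sig u).1|%N)].

Definition c_ext (q : 'I_m -> expf) (c : Aflat_type q -> C) (v : node) : C :=
  match pselect (Aflat q v) with
  | left h => c (exist _ v h)
  | right _ => 0
  end.

Definition amap (q : 'I_m -> expf) (c : {ptws Aflat_type q -> C}) : 'M[C]_(m, sQ q) :=
  \matrix_(i < m, j < sQ q)
    (let k : rat := (val j).+1%:R / (rQ q)%:R in
     if pselect (admissible_exp (Levels (q i)) k) then c_ext c (node_of q k i)
     else 0).

End PointedIrregularTypes.

Arguments compatible {R m} q.
Arguments irr_sim {R m} n' q' n q.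
Arguments rQ {R m} q.
Arguments KQ {R m} q.
Arguments sQ {R m} q.
Arguments Qa {R m} q a i.
Arguments BQ {R m} n q.
Arguments AQ {R m} q k.
Arguments node_of {R m} q k i.
Arguments admissible_node {R m} q v.
Arguments mandatory_node {R m} q v.
Arguments parent {R m} q u p.
Arguments Ram_node {R} v.
Arguments N_node {R} v b.
Arguments Aflat {R m} q.
Arguments Aflat_type {R m} q.
Arguments Rset {R m} q.
Arguments c_ext {R m} q c v.
Arguments amap {R m} q c.

(* Main.v *)
Require Import Defs.
From mathcomp Require Import all_boot all_order all_algebra.
From mathcomp Require Import all_classical all_reals all_analysis.
From mathcomp Require Import complex finmap lra.
Import numFieldTopology.Exports.
Import Order.TTheory GRing.Theory Num.Theory.
Local Open Scope ring_scope.
Local Open Scope classical_set_scope.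

Set Implicit Arguments.
Unset Strict Implicit.
Unset Printing Implicit Defensive.

(** Everything is read off the truncations of the factors.  The Galois operator
    multiplies the coefficient at [y] by [expi (- y)], a primitive root of unity
    of order the denominator of [y]; hence the stabiliser of a truncation is
    given by its ramification, the levels of [q] are the heights [k] where the
    ramification of [trunc k q] jumps, and [k > 0] is admissible iff its
    denominator divides this ramification.  Equality of all the slopes in
    [irr_sim n p n q] means that [p] and [q] have the same ramifications, and
    that their factors have equal truncations, or truncations in one orbit, at
    the same heights.  If two factors agree strictly above [k], with
    ramification [r] there, their truncations at [k] lie in one orbit iff their
    coefficients at [k] differ by a power of [expi (- k) ^+ r], a primitive
    [N]-th root of unity, i.e. iff these coefficients have equal [N]-th powers.
    This turns [irr_sim] into conditions on the coefficients, which are those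
    defining [Rset]; the map and its inverse are coordinatewise projections. *)

Local Notation den k := `|denq k|%N.

Section Topology.

Lemma matrix_continuous (T U : topologicalType) (m n : nat) (f : T -> 'M[U]_(m, n)) :
  (forall i j, continuous (fun x => f x i j)) -> continuous f.
Proof.
move=> cf x A [P nP sPA]; rewrite nbhs_filterE.
have near_entries : \forall y \near x, forall i j, P i j (f y i j).
  by apply: filter_forall => i; apply: filter_forall => j; exact: (cf i j x _ (nP i j)).
by apply: filterS near_entries => y Py; exact: sPA.
Qed.

Lemma ptws_continuous (I : Type) (T U : topologicalType) (f : T -> {ptws I -> U}) :
  (forall i, continuous (fun x => f x i)) -> continuous f.
Proof.
move=> cf x; apply/cvg_sup => i A /= [_ [[B Bop <-] Bfx sBA]].
rewrite nbhs_filterE; apply: (@filterS _ (nbhs x) _ ((fun y => f y i) @^-1` B)).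
  by move=> y By; exact: sBA.
by apply: cf; exact: open_nbhs_nbhs.
Qed.

Lemma ptws_eval_continuous (I : Type) (U : topologicalType) (i : I) :
  continuous (fun f : {ptws I -> U} => f i).
Proof.
move=> f A; rewrite nbhsE => -[B [Bop Bf] sBA].
have /cvg_sup/(_ i) cvf : f --> (f : {ptws I -> U}) by exact: cvg_id.
apply: (cvf ((fun g => g i) @^-1` A)); exists ((fun g => g i) @^-1` B).
by split=> [|//|g Bg]; [exists B|exact: sBA].
Qed.

End Topology.

Section RootsOfUnity.

Lemma mulr_nat_intE (k : rat) (d : nat) : (k * d%:R \is a Num.int) = (den k %| d)%N.
Proof.
have den_neq0 : (denq k)%:~R != 0 :> rat by rewrite intr_eq0 denq_eq0.
have -> : (den k %| d)%N = (denq k %| numq k * d%:Z)%Z.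
  rewrite Gauss_dvdzr ?/dvdz ?absz_nat //.
  by rewrite coprimez_sym coprimezE coprime_num_den.
have -> : k * d%:R = (numq k * d%:Z)%:~R / (denq k)%:~R.
  by rewrite -{1}[k]divq_num_den intrM mulrAC.
apply/idP/idP => [/intrP[z zE]|/Qint_dvdz //]; apply/dvdzP; exists z.
by apply/eqP; rewrite -(eqr_int rat) [X in _ == X]intrM -zE divfK.
Qed.

Lemma eq_expr_prim_rootP (F : fieldType) (n : nat) (z a b : F) :
  n.-primitive_root z -> a ^+ n = b ^+ n <-> exists i : nat, a = b * z ^+ i.
Proof.
move=> prim_z; split=> [ab|[i ->]]; last first.
  by rewrite exprMn exprAC (prim_expr_order prim_z) expr1n mulr1.
have [b0|b_neq0] := eqVneq b 0.
  exists 0%N; rewrite b0 mul0r; apply/eqP; move/eqP: ab.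
  by rewrite b0 [X in _ == X]expr0n gtn_eqF ?(prim_order_gt0 prim_z) // expf_eq0 => /andP[].
have /(prim_rootP prim_z)[i ab_zi] : (a / b) ^+ n = 1.
  by rewrite expr_div_n ab divff // expf_neq0.
by exists i; rewrite -ab_zi mulrC divfK.
Qed.

Variable R : realType.
Implicit Types (x y : rat) (d : nat).

Lemma expiD x y : expi (x + y) = expi x * expi y :> R[i].
Proof.
rewrite /expi rmorphD /= mulrDr cosD sinD.
apply/eqP; rewrite eq_complex /= eqxx /= addrC.
by rewrite [in X in _ + X]mulrC [in X in X + _]mulrC eqxx.
Qed.

Lemma expi0 : expi 0 = 1 :> R[i].
Proof. by rewrite /expi rmorph0 mulr0 cos0 sin0. Qed.

Lemma expiX x d : expi x ^+ d = expi (x * d%:R) :> R[i].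
Proof.
elim: d => [|d IH]; first by rewrite mulr0 expi0.
by rewrite exprS IH -expiD -[in RHS]natr1 mulrDr mulr1 addrC.
Qed.

Lemma expi_neq0 x : expi x != 0 :> R[i].
Proof.
apply/eqP => ex0; have := expiD x (- x).
by rewrite subrr ex0 mul0r expi0 => /eqP; rewrite oner_eq0.
Qed.

Lemma expi_int (z : int) : expi z%:~R = 1 :> R[i].
Proof.
have expi1 : expi 1 = 1 :> R[i].
  rewrite /expi rmorph1 mulr1 mulr_natl.
  by rewrite -[pi *+ 2]add0r cosD2pi cos0 sinD2pi sin0.
have expin d : expi d%:R = 1 :> R[i].
  by rewrite -[d%:R]mul1r -expiX expi1 expr1n.
case: z => d; first exact: expin.
by have := expiD (Negz d)%:~R d.+1%:R; rewrite NegzE mulrNz addNr expi0 expin mulr1.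
Qed.

Lemma expi_lt1_neq1 x : 0 < x < 1 -> expi x != 1 :> R[i].
Proof.
move=> /andP[x_gt0 x_lt1]; rewrite eq_complex /=; apply/nandP; left; apply/eqP.
have sin_gt0 : 0 < sin (pi * ratr x : R).
  have x_lt1R : (ratr x : R) < 1 by rewrite -[ltRHS](rmorph1 ratr) ltr_rat.
  by rewrite sin_gt0_pi// mulr_gt0 ?pi_gt0 ?ltr0q //= -[ltRHS]mulr1 ltr_pM2l ?pi_gt0.
rewrite -mulrA mulr_natl cos_mulr2n => cos_eq1.
have := exprn_gt0 2 sin_gt0; rewrite sin2cos2.
move: cos_eq1; set c := cos _ ^+ 2; lra.
Qed.

Lemma expi_eq1 x : (expi x == 1 :> R[i]) = (x \is a Num.int).
Proof.
apply/idP/idP => [|/intrP[z ->]]; last by rewrite expi_int.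
have xE : x = (Num.floor x)%:~R + (x - (Num.floor x)%:~R) by rewrite addrC subrK.
have frac_ge0 : 0 <= x - (Num.floor x)%:~R by rewrite subr_ge0 floor_le.
have frac_lt1 : x - (Num.floor x)%:~R < 1.
  by rewrite ltrBlDl -[1]/(1%:~R) -intrD floorD1_gt.
rewrite [in expi x]xE expiD expi_int mul1r; apply: contraLR => x_nint.
apply: expi_lt1_neq1; rewrite frac_lt1 andbT lt_neqAle frac_ge0 andbT eq_sym subr_eq0.
by apply: contra x_nint => /eqP ->; exact: intr_int.
Qed.

Lemma expi_prim_root x : (den x).-primitive_root (expi (- x) : R[i]).
Proof.
apply/andP; split; first by rewrite absz_gt0 denq_eq0.
apply/forallP => i; rewrite unity_rootE expiX expi_eq1 mulr_nat_intE denqN.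
apply/eqP; apply/idP/eqP => [/dvdn_leq-/(_ isT) xi|->]; last by rewrite dvdnn.
by apply/anti_leq; rewrite xi andbT; exact: ltn_ord.
Qed.

End RootsOfUnity.

Section ExponentialFactors.
Variable R : realType.
Implicit Types (p q : expf R) (D : pred rat) (x y k : rat).

Lemma expf_subE p q y : expf_sub p q y = p y - q y.
Proof.
rewrite /expf_sub fsfunE inE !mem_finsupp.
by have [->|//] := eqVneq (p y) 0; have [->|//] := eqVneq (q y) 0; rewrite subrr.
Qed.

Lemma expf_sub_eq0 p q y : (expf_sub p q y == 0) = (p y == q y).
Proof. by rewrite expf_subE subr_eq0. Qed.

Lemma expf_supp_gt0 q y : is_expf q -> q y != 0 -> 0 < y.
Proof. by move=> q_gt0 qy; apply: q_gt0; rewrite mem_finsupp. Qed.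

Definition restrict D q : expf R := [fsfun y in [fset y in finsupp q | D y]%fset => q y].

Lemma restrictE D q y : restrict D q y = if D y then q y else 0.
Proof.
rewrite /restrict fsfunE !inE /= mem_finsupp.
by case: (D y); rewrite ?andbF ?andbT //; case: eqVneq.
Qed.

Lemma truncE x q : trunc x q = restrict (<=%R x) q.
Proof. by []. Qed.

Definition trunc_gt x q : expf R := restrict (<%R x) q.

Lemma eq_restrictP D p q : restrict D p = restrict D q <-> (forall y, D y -> p y = q y).
Proof.
split=> [eq_pq y Dy|eq_pq].
  by have := congr1 (fun f : expf R => f y) eq_pq; rewrite !restrictE Dy.
by apply/fsfunP => y; rewrite !restrictE; case: ifP => // /eq_pq.
Qed.

Lemma sub_eq_restrict D D' p q :
  (forall y, D' y -> D y) -> restrict D p = restrict D q -> restrict D' p = restrict D' q.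
Proof. by move=> sDD' /eq_restrictP eq_pq; apply/eq_restrictP => y /sDD' /eq_pq. Qed.

Lemma eq_trunc_le x y p q : x <= y -> trunc x p = trunc x q -> trunc y p = trunc y q.
Proof. by move=> xy; apply: sub_eq_restrict => z; exact: le_trans. Qed.

Lemma eq_trunc_gt k x p q : k < x -> trunc_gt k p = trunc_gt k q -> trunc x p = trunc x q.
Proof. by move=> kx; apply: sub_eq_restrict => z; exact: lt_le_trans. Qed.

Lemma eq_truncP k p q :
  trunc k p = trunc k q <-> trunc_gt k p = trunc_gt k q /\ p k = q k.
Proof.
split=> [eq_pq|[/eq_restrictP eq_pq eq_k]].
  split; last exact: (proj1 (eq_restrictP _ _ _) eq_pq _ (lexx k)).
  by apply: sub_eq_restrict eq_pq => z; exact: ltW.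
by apply/eq_restrictP => y; rewrite le_eqVlt => /predU1P[<-|/eq_pq].
Qed.

Lemma le_slope q y : q y != 0 -> y <= slope q.
Proof. by move=> qy; apply: (le_bigmax_seq 0 y predT id); rewrite ?mem_finsupp. Qed.

Lemma slope_ltP q x : 0 < x -> (slope q < x) <-> (forall y, x <= y -> q y = 0).
Proof.
move=> x_gt0; split=> [sx y xy|q0].
  by apply: contra_ltP sx => /eqP /le_slope; exact: le_trans.
rewrite /slope big_seq; apply: bigmax_lt => // y; rewrite mem_finsupp => qy.
by rewrite ltNge; apply: contra qy => /q0 ->.
Qed.

Lemma slope_eqP q x : 0 < x ->
  slope q = x <-> q x != 0 /\ (forall y, x < y -> q y = 0).
Proof.
move=> x_gt0; have above_slope y : slope q < y -> q y = 0.
  by apply: contra_ltP => /eqP; exact: le_slope.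
split=> [sx|[qx q_above]].
  rewrite -sx; split=> //; apply/eqP => q_slope.
  suff : slope q < slope q by rewrite ltxx.
  apply/slope_ltP; rewrite ?sx // -sx => y; rewrite le_eqVlt => /predU1P[<- //|].
  exact: above_slope.
apply/le_anti; rewrite le_slope // andbT leNgt; apply/negP => x_lt.
suff : slope q < slope q by rewrite ltxx.
apply/slope_ltP => [|y slope_le]; first exact: lt_trans x_lt.
by apply: q_above; exact: lt_le_trans slope_le.
Qed.

Lemma slope_sub_ltP p q x : 0 < x -> (slope (expf_sub p q) < x) <-> trunc x p = trunc x q.
Proof.
move=> x_gt0; rewrite slope_ltP //; split=> [sub0|/eq_restrictP eq_pq y /eq_pq] /=.
  by apply/eq_restrictP => y /sub0/eqP; rewrite expf_sub_eq0 => /eqP.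
by move=> eq_y; apply/eqP; rewrite expf_sub_eq0 eq_y.
Qed.

Lemma slope_sub_eqP p q x : 0 < x ->
  slope (expf_sub p q) = x <-> p x != q x /\ trunc_gt x p = trunc_gt x q.
Proof.
move=> x_gt0; rewrite slope_eqP // expf_sub_eq0.
split=> -[neq_x eq_above]; split=> //.
  by apply/eq_restrictP => y /eq_above/eqP; rewrite expf_sub_eq0 => /eqP.
move=> y xy; apply/eqP; rewrite expf_sub_eq0; apply/eqP.
exact: (proj1 (eq_restrictP _ _ _) eq_above).
Qed.

Lemma eq_slope_subP p q p' q' :
  slope (expf_sub p q) = slope (expf_sub p' q') <->
  (forall x, 0 < x -> trunc x p = trunc x q <-> trunc x p' = trunc x q').
Proof.
split=> [eq_slope x x_gt0|eq_trunc]; first by rewrite -!slope_sub_ltP // eq_slope.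
have le_slope_of (f g : expf R) :
    (forall x, 0 < x -> slope f < x -> slope g < x) -> slope g <= slope f.
  move=> lt_fg; rewrite leNgt; apply/negP => lt_gf.
  by have := lt_fg _ (le_lt_trans (bigmax_ge_id _ _ _ _) lt_gf) lt_gf; rewrite ltxx.
by apply/le_anti/andP; split; apply: le_slope_of => x x_gt0;
  rewrite !slope_sub_ltP // eq_trunc.
Qed.

Lemma trunc_neq_fork p q x : 0 < x -> trunc x p <> trunc x q ->
  exists k, [/\ x <= k, trunc_gt k p = trunc_gt k q & p k != q k].
Proof.
move=> x_gt0 neq_pq; pose k := slope (expf_sub p q).
have xk : x <= k by rewrite leNgt; apply/negP => /(slope_sub_ltP _ _ x_gt0).
have [neq_k eq_above] := proj1 (slope_sub_eqP p q (lt_le_trans x_gt0 xk)) erefl.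
by exists k.
Qed.

End ExponentialFactors.

Section Ramification.
Variable R : realType.
Implicit Types (q : expf R) (D : pred rat) (x y k : rat) (d : nat).

Lemma ram_gt0 q : (0 < ram q)%N.
Proof. by rewrite /ram; case: ex_minnP => r /andP[]. Qed.

Lemma ram_dvdP q d : (ram q %| d)%N <-> (forall y, q y != 0 -> (den y %| d)%N).
Proof.
rewrite /ram; case: ex_minnP => r /andP[r_gt0 /allP r_int] r_min.
have den_dvd_r y : q y != 0 -> (den y %| r)%N.
  by move=> qy; rewrite -mulr_nat_intE; apply: r_int; rewrite mem_finsupp.
split=> [rd y /den_dvd_r /dvdn_trans|den_dvd_d]; first exact.
have [//|rd] := boolP (r %| d)%N.
suff /r_min : ram_pred q (d %% r) by rewrite leqNgt ltn_mod r_gt0.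
rewrite /ram_pred lt0n; apply/andP; split=> [//|]; apply/allP => y.
rewrite mem_finsupp mulr_nat_intE => qy.
by rewrite -(dvdn_addr _ (dvdn_mull (d %/ r) (den_dvd_r y qy))) -divn_eq den_dvd_d.
Qed.

Lemma den_dvd_ram q y : q y != 0 -> (den y %| ram q)%N.
Proof. by move=> qy; exact: (proj1 (ram_dvdP q (ram q)) (dvdnn _)). Qed.

Lemma ram_restrict_dvdP D q d :
  (ram (restrict D q) %| d)%N <-> (forall y, D y -> q y != 0 -> (den y %| d)%N).
Proof.
rewrite ram_dvdP; split=> dvd_d y; first by move=> Dy qy; apply: dvd_d; rewrite restrictE Dy.
by rewrite restrictE; case: ifP => [Dy|_]; [exact: dvd_d|rewrite eqxx].
Qed.

Lemma den_dvd_ram_restrict D q y : D y -> q y != 0 -> (den y %| ram (restrict D q))%N.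
Proof. by move=> Dy qy; exact: (proj1 (ram_restrict_dvdP D q _) (dvdnn _)). Qed.

Lemma den_dvd_ram_trunc x y q : x <= y -> q y != 0 -> (den y %| ram (trunc x q))%N.
Proof. exact: (@den_dvd_ram_restrict (<=%R x)). Qed.

Lemma ram_restrict_dvd D D' q :
  (forall y, D' y -> D y) -> (ram (restrict D' q) %| ram (restrict D q))%N.
Proof. by move=> sDD'; apply/ram_restrict_dvdP => y /sDD'; exact: den_dvd_ram_restrict. Qed.

Lemma ram_trunc_le x y q : x <= y -> (ram (trunc y q) %| ram (trunc x q))%N.
Proof. by move=> xy; apply: ram_restrict_dvd => z; exact: le_trans. Qed.

Lemma ram_trunc_dvd x q : (ram (trunc x q) %| ram q)%N.
Proof. by apply/(ram_restrict_dvdP (<=%R x)) => y _; exact: den_dvd_ram. Qed.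

Lemma trunc_coef0 k q : q k = 0 -> trunc k q = trunc_gt k q.
Proof.
move=> qk; apply/fsfunP => y; rewrite truncE !restrictE le_eqVlt.
by case: eqVneq => [<-|//]; rewrite qk if_same.
Qed.

Lemma eq_from_dvdn (r s : nat) : (forall d, (r %| d)%N <-> (s %| d)%N) -> r = s.
Proof. by move=> rs; apply/eqP; rewrite eqn_dvd; apply/andP; split; apply/rs. Qed.

(* [lcm(r, den k) / r] for [r = ram (trunc_gt k q)], the number [N_v] of the parent
   [v] of a node of height [k]. *)
Definition branch_order k q : nat :=
  (den k %/ gcdn (ram (trunc_gt k q)) (den k))%N.

Lemma branch_order_gt0 k q : (0 < branch_order k q)%N.
Proof. by rewrite divn_gt0 ?gcdn_gt0 ?ram_gt0 // dvdn_leq ?dvdn_gcdr ?absz_gt0 ?denq_neq0. Qed.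

Lemma branch_order1 k q : (den k %| ram (trunc_gt k q))%N -> branch_order k q = 1%N.
Proof. by move/gcdn_idPr; rewrite /branch_order => ->; rewrite divnn absz_gt0 denq_neq0. Qed.

End Ramification.

Section Galois.
Variable R : realType.
Implicit Types (p q : expf R) (D : pred rat) (x y k : rat) (d e i : nat).

Lemma iter_galoisE i q y : iter i galois_op q y = q y * expi (- y) ^+ i.
Proof.
elim: i => [|i IH]; first by rewrite mulr1.
rewrite iterS /galois_op fsfunE mem_finsupp.
have [q0|_] := eqVneq; last by rewrite IH -mulrA -exprSr.
by rewrite exprSr mulrA -IH q0 mul0r.
Qed.

Lemma iter_galois_coef_eq i q y :
  (iter i galois_op q y == q y) = (q y == 0) || (den y %| i)%N.
Proof.
rewrite iter_galoisE (prim_order_dvd (expi_prim_root R y)).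
have [->|qy] := eqVneq (q y) 0; first by rewrite mul0r eqxx.
by rewrite -{2}[q y]mulr1 (inj_eq (mulfI qy)).
Qed.

Lemma iter_galois_idP i q : iter i galois_op q = q <-> (ram q %| i)%N.
Proof.
rewrite ram_dvdP; split=> [qi y qy|den_dvd_i].
  by have := iter_galois_coef_eq i q y; rewrite qi eqxx (negPf qy).
apply/fsfunP => y; apply/eqP; rewrite iter_galois_coef_eq.
by have [//|/den_dvd_i] := eqVneq (q y) 0.
Qed.

Lemma iter_galois_inj i : injective (iter i (@galois_op R)).
Proof.
move=> p q eq_pq; apply/fsfunP => y.
have := congr1 (fun f : expf R => f y) eq_pq; rewrite !iter_galoisE.
by apply: mulIf; rewrite expf_neq0 // expi_neq0.
Qed.

Lemma iter_galois_eqP q (d e : nat) :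
  iter d galois_op q = iter e galois_op q <-> d = e %[mod ram q].
Proof.
wlog de : d e / (e <= d)%N => [wlog_le|].
  have [/wlog_le //|/ltnW/wlog_le ed] := leqP e d.
  by split=> [/esym/ed/esym|/esym/ed/esym].
rewrite -{1}(subnKC de) iterD; split=> [/iter_galois_inj/iter_galois_idP|/eqP].
  by rewrite -eqn_mod_dvd // => /eqP.
by rewrite eqn_mod_dvd // => /iter_galois_idP ->.
Qed.

Lemma restrict_galois D q i : restrict D (iter i galois_op q) = iter i galois_op (restrict D q).
Proof.
by apply/fsfunP => y; rewrite restrictE !iter_galoisE restrictE; case: ifP; rewrite ?mul0r.
Qed.

Lemma trunc_galois x q i : trunc x (iter i galois_op q) = iter i galois_op (trunc x q).
Proof. exact: restrict_galois. Qed.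

Lemma trunc_gt_galois x q i :
  trunc_gt x (iter i galois_op q) = iter i galois_op (trunc_gt x q).
Proof. exact: restrict_galois. Qed.

Lemma circ_galois q i : circ (iter i galois_op q) = circ q.
Proof.
apply/seteqP; split=> _ [j _ <-]; first by exists (j + i)%N; rewrite // iterD.
exists (j + i * (ram q).-1)%N => //.
rewrite -iterD -addnA -mulnSr prednK ?ram_gt0 // iterD.
by congr iter; apply/iter_galois_idP; exact: dvdn_mull.
Qed.

Lemma circ_eqP p q : circ p = circ q <-> exists e, p = iter e galois_op q.
Proof.
split=> [eq_pq|[e ->]]; last exact: circ_galois.
have : circ q p by rewrite -eq_pq; exists 0%N.
by move=> [e _ <-]; exists e.
Qed.

Lemma ram_circE q : ram_circ (circ q) = ram q.
Proof.
rewrite /ram_circ; have [i _ <-] : circ q (xget expf0 (circ q)).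
  by apply: (@xgetPex _ expf0 (circ q)); exists q; exists 0%N.
apply: eq_from_dvdn => d; rewrite -!iter_galois_idP -iterD addnC iterD.
by split=> [/iter_galois_inj|->].
Qed.

Lemma circ_trunc_eqP k p q : trunc_gt k p = trunc_gt k q ->
  circ (trunc k p) = circ (trunc k q) <->
  p k ^+ branch_order k q = q k ^+ branch_order k q.
Proof.
move=> eq_above; set r := ram (trunc_gt k q).
have prim : (branch_order k q).-primitive_root (expi (- k) ^+ r : R[i]).
  exact: exp_prim_root (expi_prim_root R k) r.
rewrite circ_eqP (eq_expr_prim_rootP _ _ prim); split=> [[e]|[i pk]].
  rewrite -trunc_galois => /eq_truncP[+ ->]; rewrite eq_above trunc_gt_galois.
  move=> /esym/iter_galois_idP/dvdnP[i ->]; exists i.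
  by rewrite iter_galoisE -exprM mulnC.
exists (r * i)%N; rewrite -trunc_galois; apply/eq_truncP; split.
  rewrite eq_above trunc_gt_galois; apply/esym/iter_galois_idP.
  exact: dvdn_mulr.
by rewrite pk iter_galoisE exprM.
Qed.

Lemma circ_trunc_le x y p q : x <= y ->
  circ (trunc x p) = circ (trunc x q) -> circ (trunc y p) = circ (trunc y q).
Proof.
move=> xy /circ_eqP[e]; rewrite -trunc_galois => /(eq_trunc_le xy).
by rewrite trunc_galois => eq_pq; apply/circ_eqP; exists e.
Qed.

End Galois.

Section Levels.
Variables (R : realType) (q : expf R).
Hypothesis q_gt0 : is_expf q.
Implicit Types (x y k l : rat) (d i : nat).

Lemma slope_sub_galois_eqP i l : 0 < l ->
  slope (expf_sub q (iter i galois_op q)) = l <->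
  (q l != 0 /\ ~~ (den l %| i)%N) /\ (ram (trunc_gt l q) %| i)%N.
Proof.
move=> l_gt0; rewrite slope_sub_eqP // eq_sym iter_galois_coef_eq negb_or.
rewrite -iter_galois_idP -trunc_gt_galois.
by split=> [[/andP[ql ndl] ->]|[[-> ->] ->]].
Qed.

Lemma LevelsP l : Levels q l <-> q l != 0 /\ ~~ (den l %| ram (trunc_gt l q))%N.
Proof.
split=> [[[i slope_l] l_neq0]|[ql ndl]].
  have l_gt0 : 0 < l by rewrite lt_neqAle eq_sym l_neq0 -slope_l; exact: bigmax_ge_id.
  have [[ql ndl] dvd_i] := proj1 (slope_sub_galois_eqP i l_gt0) slope_l.
  by split=> //; apply: contra ndl => /dvdn_trans; apply.
have l_gt0 := expf_supp_gt0 q_gt0 ql.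
split; last exact: lt0r_neq0.
by exists (ram (trunc_gt l q)); apply/slope_sub_galois_eqP.
Qed.

Lemma Levels_supp l : Levels q l -> q l != 0.
Proof. by move/LevelsP => []. Qed.

Lemma finite_Levels : finite_set (Levels q).
Proof.
apply: (@sub_finite_set _ _ [set` finsupp q]); last exact: finite_fset.
by move=> l /Levels_supp ql /=; rewrite mem_finsupp.
Qed.

(* The largest exponent whose denominator does not divide [d] is a level. *)
Lemma ram_trunc_Levels_dvdP x d :
  (ram (trunc x q) %| d)%N <-> (forall l, Levels q l -> x <= l -> (den l %| d)%N).
Proof.
split=> [dvd_d l Ll xl|dvd_d].
  by apply: dvdn_trans (den_dvd_ram_trunc xl _) dvd_d; exact: Levels_supp.
apply/ram_restrict_dvdP => y xy qy; apply/negPn/negP => ndy.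
have qd_y : expf_sub q (iter d galois_op q) y != 0.
  by rewrite expf_sub_eq0 eq_sym iter_galois_coef_eq negb_or qy.
have y_le := le_slope qd_y; set l := slope _ in y_le.
have l_gt0 : 0 < l := lt_le_trans (expf_supp_gt0 q_gt0 qy) y_le.
have [[_ ndl] _] := proj1 (slope_sub_galois_eqP d l_gt0) erefl.
case/negP: ndl; apply: dvd_d; last exact: le_trans y_le.
by split; [exists d|exact: lt0r_neq0].
Qed.

Lemma mem_fset_Levels l : l \in fset_set (Levels q) <-> Levels q l.
Proof. by rewrite in_fset_set; [rewrite in_setE|exact: finite_Levels]. Qed.

Lemma lev_ramE l : lev_ram (Levels q) l = ram (trunc l q).
Proof.
apply: eq_from_dvdn => d; rewrite ram_trunc_Levels_dvdP /lev_ram big_seq_fsetE.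
split=> [/dvdn_biglcmP dvd_d y /mem_fset_Levels Ly ly|dvd_d]; first exact: (dvd_d [` Ly]%fset).
by apply/dvdn_biglcmP => y; apply: dvd_d; apply/mem_fset_Levels; exact: fsvalP.
Qed.

Lemma ex_min_Level k l : Levels q l -> k <= l ->
  exists l0, [/\ Levels q l0, k <= l0 & forall y, Levels q y -> k <= y -> l0 <= y].
Proof.
move=> /mem_fset_Levels Ll kl.
have [l0 kl0 l0_min] := @arg_minP _ _ (fset_set (Levels q)) [` Ll]%fset
  (fun z => k <= fsval z) (@fsval _ _) kl.
exists (fsval l0); split=> // [|y /mem_fset_Levels Ly ky]; last exact: (l0_min [` Ly]%fset).
by apply/mem_fset_Levels; exact: fsvalP.
Qed.

Lemma admissible_expP k :
  admissible_exp (Levels q) k <-> 0 < k /\ (den k %| ram (trunc k q))%N.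
Proof.
split=> [[[k_gt0]|[l [Ll [/andP[k_gt0 kl]]]]]|[k_gt0 dk]].
- by rewrite Qint_def => /eqP dk; rewrite dk dvd1n.
- rewrite lev_ramE natrEint => /andP[+ _]; rewrite mulr_nat_intE => dk; split=> //.
  exact: dvdn_trans dk (ram_trunc_le q kl).
have [[l [Ll kl]]|no_level] := pselect (exists l, Levels q l /\ k <= l); last first.
  left; split=> //; rewrite -[k]mulr1 (mulr_nat_intE k 1) (dvdn_trans dk) //.
  by apply/ram_trunc_Levels_dvdP => l Ll kl; case: no_level; exists l.
have [l0 [Ll0 kl0 l0_min]] := ex_min_Level Ll kl; right; exists l0; split=> //.
split; first by rewrite k_gt0 kl0.
rewrite lev_ramE natrEint mulr_ge0 ?ler0n ?(ltW k_gt0) // andbT mulr_nat_intE.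
apply: (dvdn_trans dk); apply/ram_trunc_Levels_dvdP => y Ly ky.
by apply: (proj1 (ram_trunc_Levels_dvdP l0 _) (dvdnn _)) => //; exact: l0_min.
Qed.

Lemma admissible_exp_gt0 k : admissible_exp (Levels q) k -> 0 < k.
Proof. by move/admissible_expP => []. Qed.

Lemma supp_admissible k : q k != 0 -> admissible_exp (Levels q) k.
Proof.
move=> qk; apply/admissible_expP; split; first exact: expf_supp_gt0 qk.
exact: den_dvd_ram_trunc.
Qed.

Lemma admissible_not_LevelsP k :
  admissible_exp (Levels q) k /\ ~ Levels q k <->
  0 < k /\ (den k %| ram (trunc_gt k q))%N.
Proof.
rewrite admissible_expP LevelsP; split=> [[[k_gt0 dk] not_level]|[k_gt0 dk]].
  split=> //; have [qk|qk] := eqVneq (q k) 0; first by rewrite -trunc_coef0.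
  by apply/negPn/negP => ndk; exact: not_level.
split; last by move=> [_ /negP].
by split=> //; apply: dvdn_trans dk _; apply: ram_restrict_dvd => y; exact: ltW.
Qed.

End Levels.

Section EqualTruncations.
Variables (R : realType) (p q : expf R).
Hypotheses (p_gt0 : is_expf p) (q_gt0 : is_expf q).
Implicit Type k : rat.

Lemma eq_trunc_Levels k : trunc k p = trunc k q -> Levels p k -> Levels q k.
Proof. by move=> /eq_truncP[eq_above eq_k]; rewrite !LevelsP // eq_above eq_k. Qed.

Lemma eq_trunc_admissible k : trunc k p = trunc k q ->
  admissible_exp (Levels p) k -> admissible_exp (Levels q) k.
Proof. by move=> eq_pq; rewrite !admissible_expP // eq_pq. Qed.

End EqualTruncations.

Section EqualRamification.
Variable R : realType.
Implicit Types (p q : expf R) (k l x y : rat).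

Definition eq_ram_trunc p q := forall x, 0 < x -> ram (trunc x p) = ram (trunc x q).

Lemma eq_ram_trunc_gt p q k : is_expf p -> is_expf q -> eq_ram_trunc p q ->
  ram (trunc_gt k p) = ram (trunc_gt k q).
Proof.
have dvd_of (f g : expf R) : is_expf f -> eq_ram_trunc f g ->
    (ram (trunc_gt k f) %| ram (trunc_gt k g))%N.
  move=> f_gt0 eq_ram; apply/ram_restrict_dvdP => y ky fy.
  have y_gt0 := expf_supp_gt0 f_gt0 fy.
  apply: dvdn_trans (den_dvd_ram_trunc (lexx y) fy) _; rewrite eq_ram //.
  by apply: ram_restrict_dvd => z; exact: lt_le_trans.
move=> p_gt0 q_gt0 eq_ram; apply/eqP; rewrite eqn_dvd !dvd_of //.
by move=> x x_gt0; rewrite eq_ram.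
Qed.

Lemma eq_ram_truncP p q : is_expf p -> is_expf q ->
  eq_ram_trunc p q <->
  (forall k, p k != 0 -> admissible_exp (Levels q) k) /\
  (forall l, Levels q l -> p l != 0).
Proof.
move=> p_gt0 q_gt0; split=> [eq_ram|[p_adm p_lev] x x_gt0].
  split=> [k pk|l /LevelsP[//|ql]].
    have k_gt0 := expf_supp_gt0 p_gt0 pk; apply/admissible_expP => //; split=> //.
    by rewrite -eq_ram // den_dvd_ram_trunc.
  have l_gt0 := expf_supp_gt0 q_gt0 ql; apply: contra => /eqP pl.
  by rewrite -(eq_ram_trunc_gt _ p_gt0) // -trunc_coef0 // eq_ram // den_dvd_ram_trunc.
apply/eqP; rewrite eqn_dvd; apply/andP; split.
  apply/ram_restrict_dvdP => y xy /p_adm/(admissible_expP q_gt0)[_ dy].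
  exact: dvdn_trans dy (ram_trunc_le q xy).
by apply/(ram_trunc_Levels_dvdP q_gt0) => l /p_lev pl xl; exact: den_dvd_ram_trunc.
Qed.

End EqualRamification.

Section Fission.
Variables (R : realType) (m : nat) (n : 'I_m -> nat).
Implicit Types (p q : 'I_m -> expf R) (i j : 'I_m) (k l x : rat) (d e : nat).

Lemma irr_sim_trunc_galois p q i j d x :
  irr_sim n p n q -> 0 < x -> (d <= ram (q j))%N ->
  trunc x (p i) = iter d galois_op (trunc x (p j)) <->
  trunc x (q i) = iter d galois_op (trunc x (q j)).
Proof.
move=> [_ sim] x_gt0 d_le; rewrite -!trunc_galois.
by move: x x_gt0; apply/eq_slope_subP; exact: (sim i j 0%N d).
Qed.

Lemma irr_sim_eq_ram p q i : irr_sim n p n q -> eq_ram_trunc (p i) (q i).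
Proof.
move=> sim x x_gt0; have dvd_small d : (d <= ram (q i))%N ->
    (ram (trunc x (p i)) %| d)%N <-> (ram (trunc x (q i)) %| d)%N.
  move=> d_le; rewrite -!iter_galois_idP.
  by split=> /esym/(irr_sim_trunc_galois i sim x_gt0 d_le)/esym.
have q_dvd : (ram (trunc x (q i)) %| ram (q i))%N by exact: ram_trunc_dvd.
have p_dvd : (ram (trunc x (p i)) %| ram (q i))%N by apply/dvd_small.
apply: eq_from_dvdn => d; rewrite /dvdn -(modn_dvdm d p_dvd) -(modn_dvdm d q_dvd).
by apply: dvd_small; rewrite ltnW // ltn_pmod // ram_gt0.
Qed.

Lemma irr_simP p q : compatible q ->
  irr_sim n p n q <->
  [/\ forall i, eq_ram_trunc (p i) (q i),
      forall i j x, 0 < x -> trunc x (q i) = trunc x (q j) -> trunc x (p i) = trunc x (p j) &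
      forall i j x, 0 < x -> circ (trunc x (p i)) = circ (trunc x (p j)) ->
        trunc x (q i) = trunc x (q j)].
Proof.
move=> q_compat; split=> [sim|[eq_ram eq_trunc circ_trunc]]; last first.
  split=> // i j d e _ _; apply/eq_slope_subP => x x_gt0; rewrite !trunc_galois.
  have iter_eq_trunc : trunc x (q i) = trunc x (q j) ->
      iter d galois_op (trunc x (p i)) = iter e galois_op (trunc x (p j)) <->
      iter d galois_op (trunc x (q i)) = iter e galois_op (trunc x (q j)).
    move=> /[dup] /(eq_trunc i j x x_gt0) <- <-.
    by rewrite !iter_galois_eqP eq_ram.
  split=> eq_iter; have := congr1 circ eq_iter; rewrite !circ_galois => eq_circ.
    exact: (proj1 (iter_eq_trunc (circ_trunc i j x x_gt0 eq_circ))).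
  exact: (proj2 (iter_eq_trunc (q_compat x x_gt0 i j eq_circ))).
split=> [i|i j x x_gt0|i j x x_gt0 /circ_eqP[e]]; first exact: irr_sim_eq_ram.
  exact: (proj2 (irr_sim_trunc_galois i sim x_gt0 (leq0n (ram (q j))))).
have -> : iter e galois_op (trunc x (p j)) = iter (e %% ram (q j)) galois_op (trunc x (p j)).
  by apply/iter_galois_eqP; rewrite modn_dvdm // (irr_sim_eq_ram j sim x_gt0) ram_trunc_dvd.
have e_le : (e %% ram (q j) <= ram (q j))%N by rewrite ltnW // ltn_pmod // ram_gt0.
move/(irr_sim_trunc_galois i sim x_gt0 e_le) => eq_ij.
by apply: q_compat => //; apply/circ_eqP; exists (e %% ram (q j))%N.
Qed.

(* The conditions defining [Rset], read on the coefficients.  At a fork whose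
   height is not a level the branch order is [1], and at a level carried by one
   side only the other coefficient vanishes. *)
Definition fission_coefs q p : Prop :=
  [/\ forall i k, p i k != 0 -> admissible_exp (Levels (q i)) k,
      forall i l, Levels (q i) l -> p i l != 0,
      forall i j k, trunc k (q i) = trunc k (q j) -> p i k = p j k &
      forall i j k, trunc_gt k (q i) = trunc_gt k (q j) -> q i k != q j k ->
        p i k ^+ branch_order k (q i) != p j k ^+ branch_order k (q i)].

Lemma fork_circP p q i j k : is_expf (q i) -> is_expf (p i) -> eq_ram_trunc (p i) (q i) ->
    (forall i j k, trunc k (q i) = trunc k (q j) -> p i k = p j k) ->
    trunc_gt k (q i) = trunc_gt k (q j) ->
  circ (trunc k (p i)) = circ (trunc k (p j)) <->
  p i k ^+ branch_order k (q i) = p j k ^+ branch_order k (q i).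
Proof.
move=> qi_gt0 pi_gt0 eq_ram eq_coef eq_above.
have p_above : trunc_gt k (p i) = trunc_gt k (p j).
  by apply/eq_restrictP => y ky; apply: eq_coef; exact: eq_trunc_gt eq_above.
by rewrite (circ_trunc_eqP p_above) /branch_order -p_above (eq_ram_trunc_gt _ pi_gt0 qi_gt0).
Qed.

Lemma irr_sim_fission_coefs p q : compatible q ->
    (forall i, is_expf (q i)) -> (forall i, is_expf (p i)) ->
  irr_sim n p n q -> fission_coefs q p.
Proof.
move=> q_compat q_gt0 p_gt0 /(irr_simP _ q_compat)[eq_ram eq_trunc circ_trunc].
have coef_le0 (f : expf R) k : is_expf f -> k <= 0 -> f k = 0.
  by move=> f_gt0; apply: contra_leP => /eqP; exact: expf_supp_gt0.
have eq_coef i j k : trunc k (q i) = trunc k (q j) -> p i k = p j k.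
  have [k_le0|k_gt0] := leP k 0; first by rewrite !coef_le0.
  by move/(eq_trunc i j k k_gt0)/eq_truncP => [].
have supp_p i := proj1 (eq_ram_truncP (p_gt0 i) (q_gt0 i)) (eq_ram i).
split=> // [i|i|i j k eq_above neq_k].
- exact: (supp_p i).1.
- exact: (supp_p i).2.
have k_gt0 : 0 < k.
  by rewrite ltNge; apply: contra neq_k => k_le0; rewrite !coef_le0.
apply: contra neq_k => /eqP eq_expr; apply/eqP.
have := proj2 (fork_circP (q_gt0 i) (p_gt0 i) (eq_ram i) eq_coef eq_above) eq_expr.
by move=> /(circ_trunc i j k k_gt0)/eq_truncP[_ ->].
Qed.

Lemma fission_coefs_irr_sim p q : compatible q ->
    (forall i, is_expf (q i)) -> (forall i, is_expf (p i)) ->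
  fission_coefs q p -> irr_sim n p n q.
Proof.
move=> q_compat q_gt0 p_gt0 [p_adm p_lev p_node p_fork]; apply/irr_simP => //.
have eq_ram i : eq_ram_trunc (p i) (q i).
  by apply/eq_ram_truncP => //; split=> [k|l]; [exact: p_adm|exact: p_lev].
split=> // [i j x x_gt0 eq_q|i j x x_gt0 eq_circ].
  by apply/(eq_restrictP (<=%R x)) => y xy; apply: p_node; exact: eq_trunc_le eq_q.
apply: contrapT => /(trunc_neq_fork x_gt0)[k [xk eq_above neq_k]].
have /eqP := p_fork i j k eq_above neq_k; apply.
apply/(fork_circP (q_gt0 i) (p_gt0 i) (eq_ram i) p_node eq_above).
exact: circ_trunc_le eq_circ.
Qed.

End Fission.

Section Exponents.
Variables (R : realType) (m : nat) (q : 'I_m -> expf R).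
Hypothesis q_gt0 : forall i, is_expf (q i).
Implicit Types (i j : 'I_m) (k l x : rat).

Lemma rQ_gt0 : (0 < rQ q)%N.
Proof.
apply: (big_ind (fun r => (0 < r)%N)) => // [r s r_gt0 s_gt0|i _]; last exact: ram_gt0.
by rewrite lcmn_gt0 r_gt0.
Qed.

Lemma rQr_gt0 : 0 < (rQ q)%:R :> rat.
Proof. by rewrite ltr0n rQ_gt0. Qed.

Lemma ram_dvd_rQ i : (ram (q i) %| rQ q)%N.
Proof. by rewrite /rQ (biglcmn_sup i). Qed.

Lemma supp_le_KQ i k : q i k != 0 -> k <= KQ q.
Proof. by move=> /le_slope /le_trans; apply; exact: le_bigmax. Qed.

Lemma sQ_natr : (sQ q)%:R = KQ q * (rQ q)%:R.
Proof.
have : KQ q * (rQ q)%:R \is a Num.int.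
  rewrite mulr_nat_intE; apply: (big_ind (fun k => (den k %| rQ q)%N)) => [|k l kr lr|i _].
  - by rewrite dvd1n.
  - by rewrite maxEle; case: ifP.
  have [->|slope_neq0] := eqVneq (slope (q i)) 0; first by rewrite dvd1n.
  have slope_gt0 : 0 < slope (q i) by rewrite lt_neqAle eq_sym slope_neq0 bigmax_ge_id.
  have [/den_dvd_ram slope_dvd _] := proj1 (slope_eqP (q i) slope_gt0) erefl.
  exact: dvdn_trans slope_dvd (ram_dvd_rQ i).
have : 0 <= KQ q * (rQ q)%:R by rewrite mulr_ge0 ?ler0n //; exact: bigmax_ge_id.
rewrite /sQ => /[swap] /intrP[z ->]; rewrite numq_int ler0z => z_ge0.
by rewrite -[in RHS](gez0_abs z_ge0).
Qed.

Lemma AQ_gt0 k : AQ q k -> 0 < k.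
Proof. by move=> [i /(admissible_exp_gt0 (@q_gt0 i))]. Qed.

Lemma supp_AQ i k : q i k != 0 -> AQ q k.
Proof. by exists i; apply: supp_admissible => //; exact: q_gt0. Qed.

Lemma neq_coef_height i j k : q i k != q j k -> AQ q k /\ k <= KQ q.
Proof.
move=> neq_k; have [s qk] : exists s, q s k != 0.
  have [qi|qi] := eqVneq (q i k) 0; last by exists i.
  by exists j; move: neq_k; rewrite qi eq_sym.
by split; [exact: supp_AQ qk|exact: supp_le_KQ qk].
Qed.

Lemma AQ_natr k : AQ q k -> exists d : nat, k = d%:R / (rQ q)%:R.
Proof.
move=> [i /(admissible_expP (@q_gt0 i))[k_gt0 dk]].
have kr_int : k * (rQ q)%:R \is a Num.int.
  by rewrite mulr_nat_intE (dvdn_trans dk) // (dvdn_trans (ram_trunc_dvd _ _)) // ram_dvd_rQ.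
have : k * (rQ q)%:R \is a Num.nat by rewrite natrEint kr_int mulr_ge0 // ltW // rQr_gt0.
by move=> /natrP[d dE]; exists d; rewrite -dE mulfK // lt0r_neq0 // rQr_gt0.
Qed.

Definition next_height k l : Prop :=
  [/\ AQ q l, k < l & forall x, AQ q x -> x < l -> x <= k].

Lemma next_height_inj k k' l : AQ q k -> AQ q k' ->
  next_height k l -> next_height k' l -> k = k'.
Proof. by move=> Ak Ak' [_ kl l_min] [_ kl' l_min']; apply/le_anti; rewrite l_min ?l_min'. Qed.

Lemma ex_next_height k : AQ q k -> exists l, next_height k l.
Proof.
move=> [i _]; pose above (d : nat) := `[< AQ q (d%:R / (rQ q)%:R) /\ k < d%:R / (rQ q)%:R >].
have ex_above : exists d, above d.
  exists ((Num.truncn k).+1 * rQ q)%N; apply/asboolP.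
  rewrite natrM mulfK ?lt0r_neq0 ?rQr_gt0 // truncnS_gt; split=> //.
  by exists i; left; rewrite ltr0n natr_int.
have [d /asboolP[Ad kd] d_min] := ex_minnP ex_above; exists (d%:R / (rQ q)%:R); split=> //.
move=> x /[dup] Ax /AQ_natr[e eE]; apply: contraTT; rewrite -ltNge -leNgt eE => ke.
rewrite ler_pM2r ?invr_gt0 ?rQr_gt0 // ler_nat; apply: d_min; apply/asboolP.
by rewrite -eE in ke *.
Qed.

Lemma trunc_next_height k l i : next_height k l -> trunc l (q i) = trunc_gt k (q i).
Proof.
move=> [_ kl l_min]; apply/fsfunP => y; rewrite truncE !restrictE.
have [ly|yl] := leP l y; first by rewrite (lt_le_trans kl ly).
case: ltP => // ky; apply/esym/eqP/negPn/negP => /supp_AQ/l_min/(_ yl).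
by rewrite leNgt ky.
Qed.

End Exponents.

Section Grid.
Variables (R : realType) (m : nat) (q : 'I_m -> expf R).
Implicit Types (i : 'I_m) (j : 'I_(sQ q)) (k : rat).

Definition grid j : rat := (val j).+1%:R / (rQ q)%:R.

Lemma grid_gt0 j : 0 < grid j.
Proof. by rewrite divr_gt0 ?ltr0n ?rQ_gt0. Qed.

Lemma grid_inj : injective grid.
Proof.
move=> j j' /(mulIf (invr_neq0 (lt0r_neq0 (rQr_gt0 q)))) /eqP.
by rewrite eqr_nat eqSS => /eqP /val_inj.
Qed.

Lemma grid_le_KQ j : grid j <= KQ q.
Proof. by rewrite ler_pdivrMr ?rQr_gt0 // -sQ_natr ler_nat; exact: ltn_ord. Qed.

Lemma AQ_grid k : (forall i, is_expf (q i)) -> AQ q k -> k <= KQ q -> exists j, k = grid j.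
Proof.
move=> q_gt0 /[dup] /(AQ_gt0 q_gt0) k_gt0 /(AQ_natr q_gt0)[[|d] kE] k_le.
  by rewrite kE mul0r ltxx in k_gt0.
have d_lt : (d < sQ q)%N by rewrite -(ler_nat rat) sQ_natr -ler_pdivrMr ?rQr_gt0 // -kE.
by exists (Ordinal d_lt).
Qed.

Section Factors.
Variable a : 'M[R[i]]_(m, sQ q).

Lemma QaE i k : Qa q a i k = \sum_(j < sQ q | k == grid j) a i j.
Proof.
rewrite /Qa fsfunE; case: ifPn => // k_notin; rewrite big_pred0 // => j.
by apply: contraNF k_notin => /eqP ->; apply/imfsetP; exists j.
Qed.

Lemma Qa_grid i j : Qa q a i (grid j) = a i j.
Proof. by rewrite QaE (big_pred1 j) // => j'; rewrite (inj_eq grid_inj) eq_sym. Qed.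

Lemma Qa_notin_grid i k : ~ (exists j, k = grid j) -> Qa q a i k = 0.
Proof.
move=> k_notin; rewrite QaE big_pred0 // => j.
by apply/negP => /eqP kj; apply: k_notin; exists j.
Qed.

Lemma Qa_is_expf i : is_expf (Qa q a i).
Proof.
move=> k; rewrite mem_finsupp => Qk.
have [[j ->]|/Qa_notin_grid Qk0] := pselect (exists j, k = grid j); first exact: grid_gt0.
by rewrite Qk0 eqxx in Qk.
Qed.

End Factors.

Lemma Qa_continuous i k : continuous (fun a : 'M[R[i]]_(m, sQ q) => Qa q a i k).
Proof.
have [[j ->]|k_notin] := pselect (exists j, k = grid j).
  under eq_fun do rewrite Qa_grid; exact: coord_continuous.
under eq_fun do rewrite Qa_notin_grid //; exact: cst_continuous.
Qed.

End Grid.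
Arguments grid {R m} q j.

Section Nodes.
Variables (R : realType) (m : nat) (q : 'I_m -> expf R).
Hypotheses (q_gt0 : forall i, is_expf (q i)) (q_compat : compatible q).
Implicit Types (i j : 'I_m) (k l : rat) (u v w p : node R).

Lemma node_of_eqP k l i j : 0 < k ->
  node_of q k i = node_of q l j <-> k = l /\ trunc k (q i) = trunc k (q j).
Proof.
move=> k_gt0; split=> [[kl]|[<- eq_k]]; last by rewrite /node_of eq_k.
by rewrite -kl => /(q_compat k_gt0).
Qed.

Lemma mandatory_nodeP k i : 0 < k ->
  mandatory_node q (node_of q k i) <-> Levels (q i) k.
Proof.
move=> k_gt0; split=> [[j [/= eq_ij Lk]]|Lk]; last by exists i.
have [_ /esym] := proj1 (node_of_eqP _ _ _ k_gt0) eq_ij.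
by move/eq_trunc_Levels; apply.
Qed.

Lemma admissible_nodeP k i : 0 < k ->
  admissible_node q (node_of q k i) <-> admissible_exp (Levels (q i)) k.
Proof.
move=> k_gt0; split=> [[j [/= eq_ij Ak]]|Ak]; last by exists i.
have [_ /esym] := proj1 (node_of_eqP _ _ _ k_gt0) eq_ij.
by move/eq_trunc_admissible; apply.
Qed.

Lemma admissible_node_gt0 v : admissible_node q v -> 0 < v.1.
Proof. by move=> [i [_ /(admissible_exp_gt0 (@q_gt0 i))]]. Qed.

Lemma N_node_next_height k l i : next_height q k l ->
  N_node (node_of q l i) (den k) = branch_order k (q i).
Proof.
move=> kl; rewrite /N_node /Ram_node ram_circE (trunc_next_height q_gt0 i kl).
by rewrite /lcmn -muln_divA ?dvdn_gcdr // mulKn // ram_gt0.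
Qed.

Lemma fork_parent k i j : AQ q k -> trunc_gt k (q i) = trunc_gt k (q j) ->
  exists p, [/\ parent q (node_of q k i) p, parent q (node_of q k j) p &
    N_node p (den k) = branch_order k (q i)].
Proof.
move=> Ak eq_above; have [l kl] := ex_next_height q_gt0 Ak.
have [Al k_lt_l l_min] := kl; exists (node_of q l i); split; last exact: N_node_next_height.
  by exists i, k, l.
exists j, k, l; split=> //; apply/node_of_eqP; first exact: AQ_gt0 Al.
by rewrite !(trunc_next_height q_gt0 _ kl).
Qed.

Lemma siblings_fork u w p : parent q u p -> parent q w p ->
  exists i j k, [/\ 0 < k, u = node_of q k i, w = node_of q k j,
    trunc_gt k (q i) = trunc_gt k (q j) & N_node p (den k) = branch_order k (q i)].
Proof.
move=> [i [k [l [-> -> Al Ak [k_lt_l l_min]]]]] [j [k' [l' [-> eq_p Al' Ak' [kl' l_min']]]]].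
have [ll' eq_l] := proj1 (node_of_eqP _ _ _ (AQ_gt0 q_gt0 Al)) eq_p; subst l'.
have kl : next_height q k l by [].
have kk' : k' = k by apply: (next_height_inj Ak' Ak _ kl).
exists i, j, k; rewrite kk' -!(trunc_next_height q_gt0 _ kl).
by split=> //; [exact: AQ_gt0 Ak|exact: N_node_next_height].
Qed.

End Nodes.

Section ConfigurationSpace.
Variables (R : realType) (m : nat) (q : 'I_m -> expf R).
Hypotheses (q_gt0 : forall i, is_expf (q i)) (q_compat : compatible q).
Implicit Types (i j : 'I_m) (k l : rat) (t : 'I_(sQ q)) (u v : Aflat_type q) (p : node R).
Implicit Types (c : {ptws Aflat_type q -> R[i]}) (a : 'M[R[i]]_(m, sQ q)).

Lemma Aflat_node_of i k : admissible_exp (Levels (q i)) k -> k <= KQ q ->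
  Aflat q (node_of q k i).
Proof. by move=> Ak k_le; split=> //; exists i. Qed.

Lemma Aflat_type_inj u v : proj1_sig u = proj1_sig v -> u = v.
Proof. by case: u v => [u Au] [v Av] /= uv; apply: eq_exist. Qed.

Lemma c_extE c v : c_ext q c (proj1_sig v) = c v.
Proof.
rewrite /c_ext; case: pselect => [h|/(_ (proj2_sig v))//].
by congr (c _); apply: Aflat_type_inj.
Qed.

Lemma c_ext0 c (z : node R) : ~ Aflat q z -> c_ext q c z = 0.
Proof. by rewrite /c_ext; case: pselect. Qed.

Lemma amapE c i t : amap q c i t =
  if pselect (admissible_exp (Levels (q i)) (grid q t)) then c_ext q c (node_of q (grid q t) i)
  else 0.
Proof. by rewrite mxE. Qed.

Lemma Qa_amapE c i k : Qa q (amap q c) i k = c_ext q c (node_of q k i).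
Proof.
have [[k_adm k_le]|k_notin] := pselect (Aflat q (node_of q k i)).
  have k_gt0 : 0 < k := admissible_node_gt0 q_gt0 k_adm.
  move/(admissible_nodeP q_gt0 q_compat i k_gt0) in k_adm.
  have [t kE] : exists t, k = grid q t by apply: (AQ_grid q_gt0) => //; exists i.
  by rewrite {1}kE Qa_grid amapE -kE; case: pselect.
rewrite c_ext0 //; have [[t kE]|/Qa_notin_grid-> //] := pselect (exists t, k = grid q t).
rewrite {1}kE Qa_grid amapE -kE; case: pselect => //= k_adm; case: k_notin.
by apply: Aflat_node_of => //; rewrite kE grid_le_KQ.
Qed.

Lemma Qa_amap_node c i k v : proj1_sig v = node_of q k i -> Qa q (amap q c) i k = c v.
Proof. by move=> vE; rewrite Qa_amapE -vE c_extE. Qed.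

Lemma Level_Aflat i l : Levels (q i) l -> Aflat q (node_of q l i).
Proof.
move=> /(Levels_supp (@q_gt0 i)) ql.
by apply: Aflat_node_of; [apply: supp_admissible|exact: supp_le_KQ ql].
Qed.

Lemma Aflat_admissible i k : Aflat q (node_of q k i) -> admissible_exp (Levels (q i)) k.
Proof.
by move=> [k_adm _]; apply/(admissible_nodeP q_gt0 q_compat i (admissible_node_gt0 q_gt0 k_adm)).
Qed.

Lemma Qa_amap_admissible c i k :
  Qa q (amap q c) i k != 0 -> admissible_exp (Levels (q i)) k.
Proof.
rewrite Qa_amapE; have [/Aflat_admissible //|/c_ext0->] := pselect (Aflat q (node_of q k i)).
by rewrite eqxx.
Qed.

Section RsetCoefficients.
Variable c : {ptws Aflat_type q -> R[i]}.
Hypothesis c_Rset : Rset q c.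
Local Notation f := (Qa q (amap q c)).

Lemma Rset_Levels_neq0 i l : Levels (q i) l -> f i l != 0.
Proof.
move=> Ll; rewrite (@Qa_amap_node c i l (exist _ _ (Level_Aflat Ll))) //.
by apply: c_Rset.1; exists i.
Qed.

Section Fork.
Variables (i j : 'I_m) (k : rat).
Hypotheses (eq_above : trunc_gt k (q i) = trunc_gt k (q j)) (neq_k : q i k != q j k).

Let k_AQ : AQ q k := (neq_coef_height q_gt0 neq_k).1.
Let k_le : k <= KQ q := (neq_coef_height q_gt0 neq_k).2.
Let k_gt0 : 0 < k := AQ_gt0 q_gt0 k_AQ.

Lemma fork_nodes_neq u v :
  proj1_sig u = node_of q k i -> proj1_sig v = node_of q k j -> u <> v.
Proof.
move=> uE vE uv; move: uE; rewrite uv vE => /(node_of_eqP q_compat _ _ _ k_gt0)[_].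
by move=> /eq_truncP[_ /esym/eqP]; rewrite (negPf neq_k).
Qed.

Lemma Rset_unramified_fork : (den k %| ram (trunc_gt k (q i)))%N -> f i k != f j k.
Proof.
move=> dk; have [p [par_i par_j _]] := fork_parent q_gt0 q_compat k_AQ eq_above.
have [adm_i not_level_i] := proj2 (admissible_not_LevelsP (@q_gt0 i) k) (conj k_gt0 dk).
rewrite eq_above in dk.
have [adm_j not_level_j] := proj2 (admissible_not_LevelsP (@q_gt0 j) k) (conj k_gt0 dk).
pose u : Aflat_type q := exist _ _ (Aflat_node_of adm_i k_le).
pose v : Aflat_type q := exist _ _ (Aflat_node_of adm_j k_le).
rewrite (@Qa_amap_node c i k u) // (@Qa_amap_node c j k v) //.
apply: (c_Rset.2.1 u v p) => //; last exact: fork_nodes_neq.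
  by move/(mandatory_nodeP q_gt0 q_compat i k_gt0).
by move/(mandatory_nodeP q_gt0 q_compat j k_gt0).
Qed.

Lemma Rset_mandatory_fork : Levels (q i) k -> Levels (q j) k ->
  f i k ^+ branch_order k (q i) != f j k ^+ branch_order k (q i).
Proof.
move=> level_i level_j.
have [p [par_i par_j <-]] := fork_parent q_gt0 q_compat k_AQ eq_above.
pose u : Aflat_type q := exist _ _ (Level_Aflat level_i).
pose v : Aflat_type q := exist _ _ (Level_Aflat level_j).
rewrite (@Qa_amap_node c i k u) // (@Qa_amap_node c j k v) //.
apply: (c_Rset.2.2 u v p) => //; last exact: fork_nodes_neq.
  exact/(mandatory_nodeP q_gt0 q_compat i k_gt0).
exact/(mandatory_nodeP q_gt0 q_compat j k_gt0).
Qed.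

Lemma Rset_fork : f i k ^+ branch_order k (q i) != f j k ^+ branch_order k (q i).
Proof.
have [dk|ndk] := boolP (den k %| ram (trunc_gt k (q i)))%N.
  by rewrite branch_order1 // !expr1; exact: Rset_unramified_fork.
have level s : trunc_gt k (q s) = trunc_gt k (q i) -> q s k != 0 -> Levels (q s) k.
  by move=> eq_s qs; apply/(LevelsP (@q_gt0 s)); rewrite eq_s.
have vanishing s : trunc_gt k (q s) = trunc_gt k (q i) -> q s k = 0 -> f s k = 0.
  move=> eq_s qs; apply: contraNeq ndk => /Qa_amap_admissible.
  by move=> /(admissible_expP (@q_gt0 s))[_]; rewrite trunc_coef0 // eq_s.
have [qi|qi] := eqVneq (q i k) 0.
  rewrite vanishing // expr0n gtn_eqF ?branch_order_gt0 //= eq_sym.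
  by apply/expf_neq0/Rset_Levels_neq0/level => //; move: neq_k; rewrite qi eq_sym.
have [qj|qj] := eqVneq (q j k) 0; last by apply: Rset_mandatory_fork; exact: level.
rewrite (vanishing j) // expr0n gtn_eqF ?branch_order_gt0 //=.
by apply/expf_neq0/Rset_Levels_neq0/level.
Qed.

End Fork.

Lemma Rset_fission_coefs : fission_coefs q f.
Proof.
split; [exact: Qa_amap_admissible|exact: Rset_Levels_neq0| |exact: Rset_fork].
by move=> i j k eq_k; rewrite !Qa_amapE /node_of eq_k.
Qed.

End RsetCoefficients.

Lemma fission_coefs_siblings c u v p : fission_coefs q (Qa q (amap q c)) ->
    u <> v -> parent q (proj1_sig u) p -> parent q (proj1_sig v) p ->
  exists i k, [/\ 0 < k, proj1_sig u = node_of q k i,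
    c u ^+ branch_order k (q i) != c v ^+ branch_order k (q i) &
    N_node p (den k) = branch_order k (q i)].
Proof.
move=> [_ _ _ c_fork] uv par_u par_v.
have [i [j [k [k_gt0 uE vE eq_above N_p]]]] := siblings_fork q_gt0 q_compat par_u par_v.
exists i, k; split=> //.
rewrite -(Qa_amap_node c uE) -(Qa_amap_node c vE); apply: c_fork => //.
apply/eqP => eq_k; apply/uv/Aflat_type_inj; rewrite uE vE.
by apply/(node_of_eqP q_compat _ _ _ k_gt0); split=> //; apply/eq_truncP.
Qed.

Lemma fission_coefs_Rset c : fission_coefs q (Qa q (amap q c)) -> Rset q c.
Proof.
move=> c_coefs; have [_ c_lev _ _] := c_coefs.
split=> [v [i [vE level_i]]|]; first by rewrite -(Qa_amap_node c vE); exact: c_lev.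
split=> u v p.
- move=> not_mandatory_u _ uv par_u par_v.
  have [i [k [k_gt0 uE neq_uv _]]] := fission_coefs_siblings c_coefs uv par_u par_v.
  have adm_i : admissible_exp (Levels (q i)) k.
    by apply: Aflat_admissible; rewrite -uE; exact: proj2_sig.
  have not_level_i : ~ Levels (q i) k.
    by move/(mandatory_nodeP q_gt0 q_compat i k_gt0); rewrite -uE.
  have [_ dk] := proj1 (admissible_not_LevelsP (@q_gt0 i) k) (conj adm_i not_level_i).
  by move: neq_uv; rewrite branch_order1.
- move=> _ _ uv par_u par_v.
  have [i [k [_ uE neq_uv N_p]]] := fission_coefs_siblings c_coefs uv par_u par_v.
  by rewrite uE /= N_p.
Qed.

Definition node_factor v : 'I_m := projT1 (cid (proj2_sig v).1).

Definition node_coef a : {ptws Aflat_type q -> R[i]} :=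
  fun v => Qa q a (node_factor v) (proj1_sig v).1.

Lemma node_factorE v : proj1_sig v = node_of q (proj1_sig v).1 (node_factor v).
Proof. by rewrite /node_factor; case: cid => i []. Qed.

Lemma amapK : cancel (amap q) node_coef.
Proof.
by move=> c; apply/funext => v; rewrite /node_coef (Qa_amap_node c (node_factorE v)).
Qed.

Lemma node_coefK a : fission_coefs q (Qa q a) -> amap q (node_coef a) = a.
Proof.
move=> [a_adm _ a_node _]; apply/matrixP => i t; rewrite -!Qa_grid.
rewrite Qa_amapE; set k := grid q t; have k_gt0 : 0 < k := grid_gt0 t.
have [k_flat|k_notin] := pselect (Aflat q (node_of q k i)).
  pose v : Aflat_type q := exist _ _ k_flat.
  rewrite (c_extE _ v) /node_coef; apply: a_node.
  by have [_ /esym] := proj1 (node_of_eqP q_compat _ _ _ k_gt0) (node_factorE v).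
rewrite c_ext0 //; apply/esym/eqP; apply: contra_notT k_notin => /a_adm Ak.
by apply: Aflat_node_of => //; exact: grid_le_KQ.
Qed.

Lemma node_coef_continuous : continuous node_coef.
Proof. by apply: ptws_continuous => v; exact: Qa_continuous. Qed.

Lemma amap_continuous : continuous (amap q).
Proof.
apply: matrix_continuous => i t.
have -> : (fun c => amap q c i t) = (fun c => c_ext q c (node_of q (grid q t) i)).
  by apply/funext => c; rewrite -Qa_grid Qa_amapE.
have [k_flat|k_notin] := pselect (Aflat q (node_of q (grid q t) i)).
  have -> : (fun c => c_ext q c (node_of q (grid q t) i)) = (fun c => c (exist _ _ k_flat)).
    by apply/funext => c; exact: (c_extE c (exist _ _ k_flat)).
  exact: ptws_eval_continuous.
have -> : (fun c => c_ext q c (node_of q (grid q t) i)) = (fun=> 0).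
  by apply/funext => c; exact: c_ext0.
exact: cst_continuous.
Qed.

End ConfigurationSpace.

Theorem mainTheorem11 (R : realType) (m : nat)
  (n : 'I_m -> nat) (q : 'I_m -> expf R)
  (Hn : forall i, (0 < n i)%N)
  (Hq : forall i, is_expf (q i))
  (Horb : forall i j : 'I_m, i != j -> circ (q i) <> circ (q j))
  (Hcompat : compatible q) :
  [/\ (amap q) @` Rset q = BQ n q,
      (forall c1 c2, Rset q c1 -> Rset q c2 -> amap q c1 = amap q c2 -> c1 = c2),
      {within Rset q, continuous (amap q)} &
      exists G : 'M[R[i]]_(m, sQ q) -> {ptws Aflat_type q -> R[i]},
        (forall c, Rset q c -> G (amap q c) = c) /\
        {within BQ n q, continuous G}].
Proof.
have node_coef_amap := amapK Hq Hcompat; split.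
- apply/seteqP; split=> [_ [c cR <-]|a aB].
    by apply: fission_coefs_irr_sim => //; [exact: Qa_is_expf|exact: Rset_fission_coefs].
  have a_coefs := irr_sim_fission_coefs Hcompat Hq (@Qa_is_expf _ _ q a) aB.
  have aK := node_coefK Hq Hcompat a_coefs.
  by exists (node_coef a) => //; apply: fission_coefs_Rset => //; rewrite aK.
- by move=> c1 c2 _ _ eq_c; rewrite -(node_coef_amap c1) eq_c node_coef_amap.
- exact/continuous_subspaceT/amap_continuous.
- exists (@node_coef R m q); split=> [c _|]; first exact: node_coef_amap.
  exact/continuous_subspaceT/node_coef_continuous.
Qed.
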